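(* For every $n\in\mathbb N$, the function $\bar F_n(x)$, $x>0$, defined by $$\bar F_n(x)=\inf_{\{u_1,\dots,u_n>0\ \mid\ \sum_{j}u_j=1\}}\left(\frac{u_1}{u_2}+\dots+\frac{u_{n-1}}{u_n}+x\,u_n\right)$$ is identical to $F_n(x)$.
   Context: For $n\in\mathbb N=\{1,2,\dots\}$ and $x>0$, $$F_n(x)=\inf_{t_1,\dots,t_{n-1}\ge 0}\left(t_1+\frac{t_2}{t_1+1}+\dots+\frac{t_{n-1}}{t_{n-2}+1}+\frac{x}{t_{n-1}+1}\right),$$ that is, the infimum of $t_1+\sum_{j=2}^n \frac{t_j}{t_{j-1}+1}$ over $t_1,\dots,t_{n-1}\ge 0$ with $t_n=x$ (so $F_1(x)=x$). *)

(* Defs.v *)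
From mathcomp Require Import all_boot all_order all_algebra.
From mathcomp Require Import boolp classical_sets reals.

Set Implicit Arguments.
Unset Strict Implicit.
Unset Printing Implicit Defensive.

Import Order.TTheory GRing.Theory Num.Theory.

Local Open Scope classical_set_scope.
Local Open Scope ring_scope.

(* The sequence rcons t x is (t_1, ..., t_(n-1), t_n = x); since sequences are
   indexed from 0, t_(j+1) is s`_j.  All definitions are meant for 0 < n. *)
Definition F_obj (R : realType) (n : nat) (x : R) (t : n.-1.-tuple R) : R :=
  let s := rcons t x in
  s`_0 + \sum_(j < n.-1) s`_j.+1 / (s`_j + 1).

Definition F_values (R : realType) (n : nat) (x : R) : set R :=
  [set F_obj x t | t in [set t : n.-1.-tuple R | forall a, a \in t -> 0 <= a]].

Definition F (R : realType) (n : nat) (x : R) : R := inf (F_values n x).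

Definition Fbar_obj (R : realType) (n : nat) (x : R) (u : n.-tuple R) : R :=
  \sum_(j < n.-1) u`_j / u`_j.+1 + x * u`_n.-1.

Definition Fbar_values (R : realType) (n : nat) (x : R) : set R :=
  [set Fbar_obj x u | u in [set u : n.-tuple R |
     (forall a, a \in u -> 0 < a) /\ \sum_(j < n) u`_j = 1]].

Definition Fbar (R : realType) (n : nat) (x : R) : R := inf (Fbar_values n x).

(* inf is a total function with value 0 on sets without an infimum; the two
   lemmas below show that this convention is never used here. *)
Lemma F_values_has_inf (R : realType) (n : nat) (x : R) :
  (0 < n)%N -> 0 < x -> has_inf (F_values n x).
Proof.
move=> n0 x0; split.
  exists (F_obj x (nseq_tuple n.-1 0)), (nseq_tuple n.-1 0) => //= a.
  by rewrite mem_nseq => /andP[_ /eqP ->].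
exists 0 => _ [t /= tge0 <-].
have s0 j : 0 <= (rcons t x)`_j.
  have [jn|jn] := ltnP j (size (rcons t x)); last by rewrite nth_default.
  by move: (mem_nth 0 jn); rewrite mem_rcons inE => /orP[/eqP ->|/tge0//]; exact: ltW.
by rewrite addr_ge0 // sumr_ge0 // => j _; rewrite divr_ge0 // addr_ge0.
Qed.

Lemma Fbar_values_has_inf (R : realType) (n : nat) (x : R) :
  (0 < n)%N -> 0 < x -> has_inf (Fbar_values n x).
Proof.
move=> n0 x0; split.
  exists (Fbar_obj x (nseq_tuple n n%:R^-1)), (nseq_tuple n n%:R^-1) => //=; split.
    by move=> a; rewrite mem_nseq => /andP[_ /eqP ->]; rewrite invr_gt0 ltr0n.
  under eq_bigr => j _ do rewrite nth_nseq ltn_ord.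
  by rewrite sumr_const card_ord -[_ *+ n]mulr_natr mulVf // pnatr_eq0 -lt0n.
exists 0 => _ [u /= [ugt0 _] <-].
have u0 j : 0 <= u`_j.
  have [jn|jn] := ltnP j (size u); last by rewrite nth_default.
  exact/ltW/ugt0/mem_nth.
by rewrite addr_ge0 ?mulr_ge0 ?(ltW x0) // sumr_ge0 // => j _; rewrite divr_ge0.
Qed.

(* Main.v *)
Require Import Defs.
From mathcomp Require Import all_boot all_order all_algebra.
From mathcomp Require Import boolp classical_sets reals.
From mathcomp Require Import ring lra.

(* With partial sums S_j = u_1 + ... + u_j, the substitution t_j = S_j / u_(j+1)
   gives t_j + 1 = S_(j+1) / u_(j+1), hence t_j / (t_(j-1) + 1) = u_j / u_(j+1)
   and x / (t_(n-1) + 1) = x u_n: it carries the open simplex bijectively onto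
   the positive orthant and one objective onto the other.  Boundary points t
   are reached by shifting every t_j by a small d > 0, which raises the
   objective of F_n by at most (n - 1) d. *)

Import Order.TTheory GRing.Theory Num.Theory.

Local Open Scope ring_scope.

(** Prepending [t_0 = 0] writes the leading term as [t_1 / (t_0 + 1)], so every summand has the same
    shape; entry [j] of [0 :: t] is the mathematical [t_j]. *)
Lemma F_objE (R : realType) (n : nat) (x : R) (t : n.-tuple R) :
  @F_obj R n.+1 x t =
  \sum_(j < n) t`_j / ((0 :: t)`_j + 1) + x / ((0 :: t)`_n + 1).
Proof.
have st := size_tuple t.
transitivity (\sum_(j < n.+1) (rcons t x)`_j / ((0 :: t)`_j + 1)).
  rewrite /F_obj [RHS]big_ord_recl /= add0r divr1; congr (_ + _).
  by apply: eq_bigr => j _; rewrite /bump /= add1n /= [in X in _ = X]nth_rcons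
    [in X in X = _]nth_rcons [(rcons t x)`_j]nth_rcons st ltn_ord.
rewrite big_ord_recr /= [(rcons t x)`_n]nth_rcons st ltnn eqxx; congr (_ + _).
by apply: eq_bigr => j _; rewrite nth_rcons st ltn_ord.
Qed.

Lemma Fbar_obj_as_F_obj (R : realType) (n : nat) (x : R) (u : n.+1.-tuple R) :
  (forall a, a \in u -> 0 < a) -> \sum_(j < n.+1) u`_j = 1 ->
  exists2 t : n.-tuple R,
    (forall a, a \in t -> 0 <= a) & F_obj (n := n.+1) x t = Fbar_obj x u.
Proof.
move=> u_gt0 u_sum1.
have u_pos j : (j < n.+1)%N -> 0 < u`_j.
  by move=> jn; apply/u_gt0/mem_nth; rewrite size_tuple.
pose S k := \sum_(i < k) u`_i.
have S_pos k : (k < n.+1)%N -> 0 < S k.+1.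
  move=> kn; rewrite /S big_ord_recr /= ltr_wpDl ?u_pos //.
  by rewrite sumr_ge0 // => i _; rewrite ltW // u_pos // (ltn_trans _ kn).
pose t := [tuple S j.+1 / u`_j.+1 | j < n].
have tE j : (j < n)%N -> t`_j = S j.+1 / u`_j.+1.
  by move=> jn; rewrite -[j]/(nat_of_ord (Ordinal jn)) -tnth_nth tnth_mktuple.
(* At [j = 0] this reads [0 + 1 = u_1 / u_1], so the convention [t_0 = 0] fits the substitution. *)
have t1E j : (j < n.+1)%N -> (0 :: t)`_j + 1 = S j.+1 / u`_j.
  case: j => [|j] jn; have uj := u_pos _ jn.
    by rewrite add0r /S big_ord1 divff // gt_eqF.
  by rewrite [(0 :: t)`_j.+1]tE // /S [in RHS]big_ord_recr /= mulrDl divff // gt_eqF.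
exists t.
  move=> a /tnthP[j ->]; rewrite tnth_mktuple divr_ge0 // ltW ?u_pos ?S_pos ?ltnS //.
  exact: ltnW.
rewrite F_objE /Fbar_obj /=; congr (_ + _).
  apply: eq_bigr => j _; have jn := ltn_ord j; have jn1 := ltnW jn.
  rewrite tE // t1E ?ltnS //.
  have := S_pos _ jn1; have := u_pos _ jn1; have := u_pos j.+1 jn => ? ? ?.
  by field; rewrite !gt_eqF.
by rewrite t1E // [S n.+1]u_sum1 div1r invrK.
Qed.

(** Inverts the substitution: [S_j / S_(j+1) = t_j / (t_j + 1)] recovers the partial sums as
    products going down from [S_(n+1) = 1], and then [u_(j+1) = S_(j+1) / (t_j + 1)]. Strict
    positivity of [t] keeps these products, hence [u], positive. *)
Lemma F_obj_as_Fbar_obj (R : realType) (n : nat) (x : R) (t : n.-tuple R) :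
  (forall a, a \in t -> 0 < a) ->
  exists2 u : n.+1.-tuple R,
    (forall a, a \in u -> 0 < a) /\ \sum_(j < n.+1) u`_j = 1 &
    Fbar_obj x u = F_obj (n := n.+1) x t.
Proof.
move=> t_gt0.
have t_pos j : (j < n)%N -> 0 < t`_j.
  by move=> jn; apply/t_gt0/mem_nth; rewrite size_tuple.
pose T := nth 0 (0 :: t).
have T1_pos j : 0 < T j + 1.
  case: j => [|j]; rewrite /T /= ?add0r //.
  have [jn|jn] := ltnP j n; first by rewrite addr_gt0 ?t_pos.
  by rewrite nth_default ?size_tuple // add0r.
(* P j is the partial sum u_1 + ... + u_j, normalised by P n.+1 = 1. *)
pose P j := \prod_(j <= k < n.+1) (T k / (T k + 1)).
have PS j : (j < n.+1)%N -> P j = T j / (T j + 1) * P j.+1.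
  by move=> jn; rewrite /P big_ltn.
have P_pos j : 0 < P j.+1.
  rewrite /P big_nat_cond prodr_gt0 // => -[|k] //.
  by rewrite andbT => /andP[_ kn]; rewrite divr_gt0 ?T1_pos // t_pos.
pose u := [tuple P j.+1 / (T j + 1) | j < n.+1].
have uE j : (j < n.+1)%N -> u`_j = P j.+1 / (T j + 1).
  by move=> jn; rewrite -[j]/(nat_of_ord (Ordinal jn)) -tnth_nth tnth_mktuple.
exists u; first split.
- by move=> a /tnthP[j ->]; rewrite tnth_mktuple divr_gt0.
(* The sum telescopes to [P n.+1 - P 0]: the first is an empty product, the second contains the
   factor [T 0 = 0]. *)
- transitivity (\sum_(0 <= j < n.+1) (P j.+1 - P j)).
    rewrite big_mkord; apply: eq_bigr => j _; rewrite uE // [P j]PS //.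
    by have := T1_pos j => ?; field; rewrite gt_eqF.
  by rewrite telescope_sumr // /P big_geq // big_ltn // /T /= !mul0r subr0.
rewrite F_objE /Fbar_obj /=; congr (_ + _).
  apply: eq_bigr => j _; have jn := ltn_ord j; have jn1 := ltnW jn.
  rewrite !uE ?ltnS // [P j.+1]PS ?ltnS // -/T -[t`_j]/(T j.+1).
  have := T1_pos j; have := T1_pos j.+1; have := P_pos j.+1 => ? ? ?.
  by field; rewrite !gt_eqF.
by rewrite -[x * _]/(x * u`_n) uE // /P big_geq // mul1r.
Qed.

(** The shift only enlarges denominators, so increases come from the [n] numerators alone; each
    costs at most [d] because its denominator is at least 1. *)
Lemma F_obj_shift (R : realType) (n : nat) (x d : R) (t : n.-tuple R) :
  0 <= x -> 0 <= d -> (forall a, a \in t -> 0 <= a) ->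
  F_obj (n := n.+1) x [tuple of [seq a + d | a <- t]] <=
  F_obj (n := n.+1) x t + n%:R * d.
Proof.
move=> x_ge0 d_ge0 t_ge0.
have T_ge0 j : 0 <= (0 :: t)`_j.
  case: j => [|j] //=; have [jn|jn] := ltnP j n.
    by apply/t_ge0/mem_nth; rewrite size_tuple.
  by rewrite nth_default ?size_tuple.
have T_le j : (j <= n)%N -> (0 :: t)`_j <= (0 :: [seq a + d | a <- t])`_j.
  by case: j => [|j] //= jn; rewrite (nth_map 0) ?size_tuple // lerDl.
have inv_le j : (j <= n)%N ->
    ((0 :: [seq a + d | a <- t])`_j + 1)^-1 <= ((0 :: t)`_j + 1)^-1.
  move=> jn; have := T_le j jn; have := T_ge0 j => ? ?.
  by rewrite lef_pV2 ?posrE; lra.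
rewrite !F_objE addrAC lerD //; last by rewrite ler_wpM2l // inv_le.
rewrite -[n in n%:R * d]card_ord mulr_natl -sumr_const -big_split /=.
apply: ler_sum => j _; have jn := ltn_ord j.
rewrite (nth_map 0) ?size_tuple //.
have t_j := T_ge0 j.+1; have T_j := T_ge0 j.
apply: (le_trans (y := (t`_j + d) / ((0 :: t)`_j + 1))).
  by rewrite ler_wpM2l ?addr_ge0 // inv_le // ltnW.
rewrite mulrDl lerD2l ler_pdivrMr; last by lra.
by rewrite ler_peMr //; lra.
Qed.

Theorem proposition2p1 (R : realType) (n : nat) (hn : (0 < n)%N) (x : R)
    (hx : 0 < x) : Fbar n x = F n x.
Proof.
have [F_nonempty F_lb] := @F_values_has_inf R n x hn hx.
have [Fbar_nonempty Fbar_lb] := @Fbar_values_has_inf R n x hn hx.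
case: n hn F_nonempty F_lb Fbar_nonempty Fbar_lb => // n _.
move=> F_nonempty F_lb Fbar_nonempty Fbar_lb; apply/eqP; rewrite eq_le; apply/andP; split.
- apply: lb_le_inf => // _ [t t_ge0 <-]; apply/ler_addgt0Pr => e e_gt0.
  (* The total cost [n * d] stays below [e]; dividing by [n.+1] also covers [n = 0]. *)
  pose d := e / n.+1%:R; have d_gt0 : 0 < d by rewrite divr_gt0.
  have [|u u_simplex u_obj] :=
      @F_obj_as_Fbar_obj R n x [tuple of [seq a + d | a <- t]].
    by move=> _ /mapP[a /t_ge0 a_ge0 ->]; rewrite ltr_wpDl.
  apply: (le_trans (y := Fbar_obj x u)); first by apply: ge_inf => //; exists u.
  rewrite u_obj; apply: le_trans (@F_obj_shift R n x d t (ltW hx) (ltW d_gt0) t_ge0) _.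
  by rewrite lerD2l /d mulrCA ger_pMr // ler_pdivrMr // mul1r ler_nat.
- apply: lb_le_inf => // _ [u [u_gt0 u_sum1] <-].
  have [t t_ge0 <-] := @Fbar_obj_as_F_obj R n x u u_gt0 u_sum1.
  by apply: ge_inf => //; exists t.
Qed.
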